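(* Let $k\ge2$ and let $\mathcal A$ be a $k$th-order homogeneous operator on $\mathbb R^n$-variables, from a space $V$ to a space $W$. Then there exists a first-order operator $\mathcal B$ on $\mathbb R^n$-variables, from $V\otimes E_{k-1}(\mathbb R^n)$ to a (finite-dimensional) vector space $Z$ containing $W$, satisfying the following properties, where $P_W:Z\to W$ denotes the canonical linear projection: (i) Functional factorization: $\mathcal A$ can be decomposed as $$\mathcal A(D)=P_W\circ\mathcal B(D)\circ D^{k-1}.$$ (ii) Algebraic stability: if $\mathbb K\in\{\mathbb R,\mathbb C\}$, then $$\mathbb A^k(\xi)[v]=P_W\circ\mathbb B(\xi)[v\otimes\xi^{\otimes(k-1)}]\qquad\text{for all }(\xi,v)\in\mathbb K^n\times(\mathbb K\otimes V).$$ (iii) Kernel stability: if $\mathbb K\in\{\mathbb R,\mathbb C\}$, then $$\ker_{\mathbb K}\mathbb B(\xi)=\ker_{\mathbb K}\mathbb A^k(\xi)\otimes\mathrm{span}_{\mathbb K}\{\xi^{\otimes(k-1)}\}\qquad\text{for all }\xi\in\mathbb K^n\setminus\{0\}.$$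
   Context: $V,W$ are finite-dimensional real inner product spaces. A $k$th-order homogeneous operator is a linear constant-coefficient differential operator $\mathcal A(D)u=\mathcal A u=\sum_{|\alpha|=k}A_\alpha\partial^\alpha u$ with $A_\alpha\in\mathrm{Lin}(V;W)$, with principal symbol $\mathbb A^k(\xi)=\sum_{|\alpha|=k}\xi^\alpha A_\alpha$. Similarly a first-order operator $\mathcal B$ is homogeneous of order one with constant coefficients, $\mathcal B w=\sum_{j=1}^nB_j\partial_jw$, with symbol $\mathbb B(\xi)=\sum_j\xi_jB_j$. No ellipticity is assumed. $E_{r}(\mathbb R^n)=\mathrm{span}\{e^{\otimes r}:e\in\mathbb R^n\}$ is the space of symmetric $r$-tensors on $\mathbb R^n$, and $D^{k-1}u$ is the full $(k-1)$-st derivative, with values in $V\otimes E_{k-1}(\mathbb R^n)$. For $\xi\in\mathbb K^n$, symbols are extended $\mathbb K$-linearly: $\mathbb A^k(\xi):\mathbb K\otimes V\to\mathbb K\otimes W$ and $\mathbb B(\xi):\mathbb K\otimes V\otimes E_{k-1}(\mathbb R^n)\to\mathbb K\otimes Z$ (and $P_W$ is likewise extended), and $\ker_{\mathbb K}$ denotes the kernels of these $\mathbb K$-linear maps. $W$ sits in $Z$ as a direct summand and $P_W$ is the corresponding projection. *)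

(* Defs.v *)
From HB Require Import structures.
From mathcomp Require Import all_boot all_order all_algebra.
From mathcomp Require Import all_classical all_reals all_analysis.
From mathcomp Require Import complex.
Set Implicit Arguments.
Unset Strict Implicit.
Unset Printing Implicit Defensive.
Import Order.TTheory GRing.Theory Num.Theory.
Import numFieldNormedType.Exports.
Local Open Scope classical_set_scope.
Local Open Scope ring_scope.

Definition lspan (K : fieldType) (X : lmodType K) (S : set X) : set X :=
  [set x | exists (m : nat) (c : 'I_m -> K) (s : 'I_m -> X),
     (forall i, S (s i)) /\ x = \sum_(i < m) c i *: s i].

Lemma vspan_exists (K : fieldType) (X : vectType K) (S : set X) :
  exists U : {vspace X}, forall x, x \in U <-> lspan S x.
Proof.
pose P d := `[< exists s : seq X, (forall x, x \in s -> S x) /\ \dim (span s) = d >].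
have exP : exists d, P d by exists (\dim (span ([::] : seq X))); apply/asboolP; exists [::].
have ubP d : P d -> (d <= \dim {:X})%N.
  by move=> /asboolP[s [_ <-]]; exact/dimvS/subvf.
case: (ex_maxnP exP ubP) => d /asboolP[s [sS sd]] dmax.
have SU x : S x -> x \in span s.
  move=> Sx.
  have : P (\dim (span (x :: s))).
    apply/asboolP; exists (x :: s); split => // y.
    by rewrite inE => /orP[/eqP->//|/sS].
  move=> /dmax; rewrite -sd => le_dim.
  have sub : (span s <= span (x :: s))%VS by rewrite span_cons addvSr.
  have /eqP -> : span s == span (x :: s) by rewrite eqEdim sub.
  by apply: memv_span; rewrite inE eqxx.
exists (span s) => x; split.
  move=> xs; exists (size s), (fun i => coord (in_tuple s) i x), (fun i => s`_i).
  by split; [move=> i; apply/sS/mem_nth | exact: (@coord_span _ _ _ (in_tuple s))].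
by move=> [m [c [t [tS ->]]]]; apply: memv_suml => i _; apply/memvZ/SU.
Qed.

Definition vspan (K : fieldType) (X : vectType K) (S : set X) : {vspace X} :=
  projT1 (cid (vspan_exists S)).

Lemma vspanP (K : fieldType) (X : vectType K) (S : set X) (x : X) :
  x \in vspan S <-> lspan S x.
Proof. exact: (projT2 (cid (vspan_exists S))). Qed.

(* [tens n r X] is the model of X ⊗ (K^n)^{⊗r} in which a tensor is the array
   of its coefficients on the e_{t_1} ⊗ ... ⊗ e_{t_r}. *)
Definition tens (n r : nat) (X : Type) := {ffun r.-tuple 'I_n -> X}.

Definition tpow (K : fieldType) (n r : nat) (e : 'rV[K]_n) : tens n r K^o :=
  [ffun t => \prod_(j < r) e 0 (tnth t j)].

Definition tprod (K : fieldType) (X : lmodType K) (n r : nat)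
    (v : X) (s : tens n r K^o) : tens n r X :=
  [ffun t => s t *: v].

Definition tens_of (K : fieldType) (X : lmodType K) (n r : nat)
    (S : set X) (T : set (tens n r K^o)) : set (tens n r X) :=
  lspan [set tprod v s | v in S & s in T].

Definition symtens (K : fieldType) (n r : nat) : set (tens n r K^o) :=
  lspan [set tpow r e | e in [set: 'rV[K]_n]].

(* V ⊗ E_r(R^n), as a subspace of V ⊗ (R^n)^{⊗r} and then as a type. *)
Definition symtensv (R : fieldType) (V : vectType R) (n r : nat) :
    {vspace tens n r V} :=
  vspan (tens_of [set: V] (@symtens R n r)).

Definition VE (R : fieldType) (V : vectType R) (n r : nat) :=
  subvs_of (symtensv V n r).

(* The pair (x, y) stands for x + i y, i.e. 1 ⊗ x + i ⊗ y in C ⊗ V. *)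
Definition cplx (R : realType) (V : lmodType R) : Type := (V * V)%type.

Section ComplexificationModule.
Context (R : realType) (V : lmodType R).

HB.instance Definition _ := GRing.Zmodule.copy (cplx V) (V * V)%type.

Definition cplx_scale (c : R[i]) (z : cplx V) : cplx V :=
  (complex.Re c *: z.1 - complex.Im c *: z.2,
   complex.Re c *: z.2 + complex.Im c *: z.1).

Let cplx_scaleA a b z : cplx_scale a (cplx_scale b z) = cplx_scale (a * b) z.
Proof.
case: a b z => [a1 a2] [b1 b2] [x y]; rewrite /cplx_scale /=.
congr (_, _); rewrite !(scalerBr, scalerDr, scalerA, scalerBl, scalerDl).
  by rewrite !opprD (addrC (- ((a2 * b1) *: y))) addrACA.
by rewrite (addrC ((a2 * b1) *: x)) addrACA.
Qed.

Let cplx_scale1 : left_id 1 cplx_scale.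
Proof.
by case=> x y; rewrite /cplx_scale /= !scale1r !scale0r subr0 addr0.
Qed.

Let cplx_scaleDr : right_distributive cplx_scale +%R.
Proof.
case=> [a1 a2] [x y] [x' y']; rewrite /cplx_scale /=.
by congr (_, _); rewrite !scalerDr ?opprD addrACA.
Qed.

Let cplx_scaleDl z : {morph cplx_scale^~ z : a b / a + b}.
Proof.
move=> [a1 a2] [b1 b2]; case: z => x y; rewrite /cplx_scale /=.
by congr (_, _); rewrite !scalerDl ?opprD addrACA.
Qed.

HB.instance Definition _ := GRing.Zmodule_isLmodule.Build R[i] (cplx V)
  cplx_scaleA cplx_scale1 cplx_scaleDr cplx_scaleDl.

End ComplexificationModule.

Definition cmap (R : realType) (V W : vectType R) (f : 'Hom(V, W))
  (z : cplx V) : cplx W := (f z.1, f z.2).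

(* The inclusion of C ⊗ (V ⊗ E_r(R^n)) in (C ⊗ V) ⊗ (C^n)^{⊗r}, and a left
   inverse of it. *)
Definition cval (R : realType) (V : vectType R) (n r : nat)
    (w : cplx (VE V n r)) : tens n r (cplx V) :=
  [ffun t => (vsval w.1 t, vsval w.2 t)].

Definition cproj (R : realType) (V : vectType R) (n r : nat)
    (z : tens n r (cplx V)) : cplx (VE V n r) :=
  (vsproj (symtensv V n r) [ffun t => (z t).1],
   vsproj (symtensv V n r) [ffun t => (z t).2]).

(* v ⊗ ξ^{⊗r} as an element of K ⊗ V ⊗ E_r(R^n). The array tprod v (tpow r xi)
   (its real and imaginary parts if K = C) is symmetric and hence already lies
   in V ⊗ E_r(R^n): vsproj only supplies the change of type. *)
Definition tvec (R : realType) (V : vectType R) (n r : nat)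
    (v : V) (xi : 'rV[R]_n) : VE V n r :=
  vsproj (symtensv V n r) (tprod v (tpow r xi)).

Definition ctvec (R : realType) (V : vectType R) (n r : nat)
    (v : cplx V) (xi : 'rV[R[i]]_n) : cplx (VE V n r) :=
  cproj (tprod v (tpow r xi)).

(* α_i <= |α| = k, so the α_i range over a finite type. *)
Definition mindex (n k : nat) :=
  {a : {ffun 'I_n -> 'I_k.+1} | (\sum_i a i == k)%N}.

(* Over K = R the coefficients are the A_α themselves; over K = C they are the
   cmap (A_α). *)
Definition symbol (K : fieldType) (X Y : lmodType K) (n k : nat)
    (A : mindex n k -> X -> Y) (xi : 'rV[K]_n) (v : X) : Y :=
  \sum_(a : mindex n k) (\prod_i xi 0 i ^+ val a i) *: A a v.

Definition symbol1 (K : fieldType) (X Y : lmodType K) (n : nat)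
    (B : 'I_n -> X -> Y) (xi : 'rV[K]_n) (w : X) : Y :=
  \sum_j xi 0 j *: B j w.

Definition kerset (U : Type) (Y : nmodType) (f : U -> Y) : set U :=
  [set v | f v = 0].

(* A map with values in a finite-dimensional space is differentiated
   coordinatewise in the basis [vbasis fullv]; neither the derivative nor its
   existence depends on the basis. *)
Definition vcoord (R : realType) (V : vectType R) (n : nat)
    (u : 'rV[R]_n -> V) (b : 'I_(\dim {:V})) (x : 'rV[R]_n) : R :=
  coord (vbasis {:V}) b (u x).

Definition pd (R : realType) (V : vectType R) (n : nat) (i : 'I_n)
    (u : 'rV[R]_n -> V) (x : 'rV[R]_n) : V :=
  \sum_b ('D_(delta_mx 0 i) (vcoord u b) x) *: (vbasis {:V})`_b.

Fixpoint Ck (R : realType) (V : vectType R) (n k : nat)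
    (u : 'rV[R]_n -> V) : Prop :=
  (forall b, continuous (vcoord u b)) /\
  if k is k'.+1 then
    forall i : 'I_n,
      (forall b x, derivable (vcoord u b) x (delta_mx 0 i)) /\ Ck k' (pd i u)
  else True.

Definition pdm (R : realType) (V : vectType R) (n k : nat) (a : mindex n k)
    (u : 'rV[R]_n -> V) : 'rV[R]_n -> V :=
  foldr (fun i f => iter (val a i) (pd i) f) u (enum 'I_n).

Definition diffop (R : realType) (V W : vectType R) (n k : nat)
    (A : mindex n k -> 'Hom(V, W)) (u : 'rV[R]_n -> V) (x : 'rV[R]_n) : W :=
  \sum_(a : mindex n k) A a (pdm a u x).

Definition diffop1 (R : realType) (V Z : vectType R) (n : nat)
    (B : 'I_n -> 'Hom(V, Z)) (w : 'rV[R]_n -> V) (x : 'rV[R]_n) : Z :=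
  \sum_j B j (pd j w x).

(* The entry of D^r u at (t_1, ..., t_r) is ∂_{t_1} ... ∂_{t_r} u. For u of
   class C^r this array is symmetric and hence lies in V ⊗ E_r(R^n): here too
   vsproj only supplies the change of type. *)
Definition fullD (R : realType) (V : vectType R) (n r : nat)
    (u : 'rV[R]_n -> V) (x : 'rV[R]_n) : VE V n r :=
  vsproj (symtensv V n r) [ffun t : r.-tuple 'I_n => foldr (@pd R V n) u t x].

(* Main.v *)
Require Import Defs.
From HB Require Import structures.
From mathcomp Require Import all_boot all_order all_algebra.
From mathcomp Require Import all_classical all_reals all_analysis.
From mathcomp Require Import complex.
From mathcomp Require Import perm.
Set Implicit Arguments.
Unset Strict Implicit.
Unset Printing Implicit Defensive.
Import Order.TTheory GRing.Theory Num.Theory.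
Import numFieldNormedType.Exports.
Local Open Scope classical_set_scope.
Local Open Scope ring_scope.

(** Write r = k - 1, so that the full derivative of u takes values in V (x) E_r.

    The operator B has two components, one with values in W and one measuring
    how far an array is from being a gradient. For the first, write each
    multi-index alpha of length k as a word i t of indices, with first letter i
    and tail t of length r: then the derivative of order alpha is the partial
    derivative d_i of the t-th entry of D^r u, so A is a first-order operator
    applied to D^r u ([first_order]). This alone gives (i) and (ii), but its
    kernel is much too large. The second component is the curl
      (p, i, t) |-> d_i w_t - d_(t_p) w_(t with t_p replaced by i),
    which vanishes on every D^r u and every v (x) xi^(x)r. Conversely, if xi_i is
    not 0 and the symbol of the curl kills w, then all indices of w can be
    traded for i, and w_t = (xi_(t_1) ... xi_(t_r)) v for a fixed vector v
    ([curl_free_rank_one]). On such a tensor the first component acts as the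
    symbol of A on v, so the common kernel is exactly the one in (iii). The
    argument is linear algebra over any field, so [curl_kernel] serves both the
    real and the complex case.

    What remains is to see that the tensors at hand belong to V (x) E_r, which is
    defined as the span of the v (x) e^(x)r with e real: D^r u, and the real and
    imaginary parts of v (x) xi^(x)r for complex xi. Both are symmetric arrays,
    the first because partial derivatives commute ([derive_comm], proved with
    the mean value theorem, and [foldr_pd_perm]), and a symmetric array lies in
    the span by polarization ([symmetric_in_symtensv]). *)

(** * Polarization: symmetric arrays are spanned by powers *)

(** Inclusion-exclusion: the S that contribute are those containing the range of
    f, and their signs cancel unless the range is everything, that is, unless f is
    injective. *)
Lemma alternating_sum_range (K : comNzRingType) (r : nat)
    (f : {ffun 'I_r -> 'I_r}) :
  \sum_(S : {set 'I_r}) (-1) ^+ #|~: S| * \prod_p (f p \in S)%:R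
  = (injectiveb f)%:R :> K.
Proof.
(* Expanding the product of all 1 + G i yields the sum over S, since the
   factor at i outside S can survive only if i is not in the range of f. *)
pose G i : K := - (i \notin codom f)%:R.
have termE (S : {set 'I_r}) : (-1) ^+ #|~: S| * \prod_p (f p \in S)%:R
    = \prod_i (if i \in S then 1 else G i).
  have [/forallP fS|] := boolP [forall p, f p \in S].
    rewrite big1 => [|p _]; last by rewrite fS.
    rewrite mulr1 -prodr_const big_mkcond; apply: eq_bigr => i _ /=.
    rewrite finset.in_setC; have [//|iS /=] := boolP (i \in S); rewrite /G.
    suff -> : i \notin codom f by [].
    by apply: contra iS => /codomP[p ->].
  rewrite negb_forall => /existsP[p fpS].
  rewrite (bigD1 p) //= (negbTE fpS) mul0r mulr0.
  by rewrite (bigD1 (f p)) //= (negbTE fpS) /G codom_f oppr0 mul0r.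
under eq_bigr do rewrite termE.
transitivity (\prod_i (1 + G i)); first by rewrite bigA_distr.
have [/injectiveP injf|/injectiveP ninjf] := boolP (injectiveb f).
  apply: big1 => i _; rewrite /G.
  have /codomP[p ->] : i \in codom f.
    by rewrite (injF_onto injf).
  by rewrite codom_f oppr0 addr0.
have [i iNf] : exists i, i \notin codom f.
  apply/existsP; rewrite -negb_forall; apply/negP => /forallP fonto.
  apply: ninjf; apply/injectiveP; rewrite /injectiveb.
  rewrite /dinjectiveb; apply/card_uniqP.
  rewrite size_map -cardE; apply: eq_card => i.
  by have := fonto i; rewrite /codom /image_mem => ->.
by rewrite (bigD1 i) //= /G iNf subrr mul0r.
Qed.

(** Ryser's formula for the permanent: expand the product over p into a sum over
    all maps f, of which the alternating sum over S retains the permutations. It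
    gives the polarization identity with explicit coefficients. *)
Lemma ryser_permanent (K : comNzRingType) (r : nat) (M : 'I_r -> 'I_r -> K) :
  \sum_(S : {set 'I_r}) (-1) ^+ #|~: S| * \prod_p \sum_(j in S) M p j
  = \sum_(s : 'S_r) \prod_p M p (s p).
Proof.
transitivity (\sum_(f : {ffun 'I_r -> 'I_r})
    (injectiveb f)%:R * \prod_p M p (f p)).
  transitivity (\sum_(S : {set 'I_r}) \sum_(f : {ffun 'I_r -> 'I_r})
      (-1) ^+ #|~: S| * (\prod_p (f p \in S)%:R) * \prod_p M p (f p)).
    apply: eq_bigr => S _.
    under eq_bigr do rewrite big_mkcond.
    rewrite bigA_distr_bigA big_distrr /=; apply: eq_bigr => f _.
    rewrite -mulrA -big_split /=; congr (_ * _); apply: eq_bigr => p _.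
    by case: ifP; rewrite ?mul1r ?mul0r.
  rewrite exchange_big; apply: eq_bigr => f _ /=.
  by rewrite -mulr_suml alternating_sum_range.
rewrite (bigID (fun f : {ffun 'I_r -> 'I_r} => injectiveb f)) /= addrC.
rewrite big1 ?add0r => [|f /negbTE->]; last by rewrite mul0r.
rewrite (reindex (@pval _)) /=; last first.
  pose in_Sr := insubd (1%g : 'S_r).
  by exists in_Sr => /= f Uf; first apply: val_inj; apply: insubdK.
apply: eq_big => /= [s | s _]; rewrite ?(valP s) // mul1r.
by apply: eq_bigr => p _; rewrite pvalE.
Qed.

Lemma mem_lspan (K : fieldType) (X : lmodType K) (S : set X) x :
  S x -> lspan S x.
Proof.
by move=> Sx; exists 1%N, (fun=> 1), (fun=> x); rewrite big_ord1 scale1r.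
Qed.

Definition tuple_perm (T : Type) (r : nat) (s : 'S_r) (t : r.-tuple T) :
  r.-tuple T := [tuple tnth t (s p) | p < r].

Definition symmetric_tens (n r : nat) (X : Type) (w : tens n r X) : Prop :=
  forall (s : 'S_r) t, w (tuple_perm s t) = w t.

(** The sum of all permutations of a basis tensor e_(t_1) (x) ... (x) e_(t_r) is
    a combination of r-th powers, by Ryser's formula applied to a matrix of
    Kronecker deltas. A symmetric w is the average of its permutations, so dividing by
    r! writes it in terms of powers. *)
Lemma symmetric_in_symtensv (R : numFieldType) (V : vectType R) (n r : nat)
    (w : tens n r V) : symmetric_tens w -> w \in symtensv V n r.
Proof.
move=> symw.
(* The polarization identity uses the r-th powers of the sums of the basis
   vectors e_(t_j) over the positions j in S. *)
pose e (S : {set 'I_r}) (t : r.-tuple 'I_n) : 'rV[R]_n :=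
  \row_i \sum_(j in S) (i == tnth t j)%:R.
have fact_neq0 : (r`!)%:R != 0 :> R by rewrite pnatr_eq0 -lt0n fact_gt0.
have -> : w = \sum_(t : r.-tuple 'I_n) \sum_(S : {set 'I_r})
    ((r`!)%:R^-1 * (-1) ^+ #|~: S|) *: tprod (w t) (tpow r (e S t)).
  apply/ffunP => t; rewrite sum_ffunE.
  apply: (@scalerI _ _ (r`!)%:R) => //.
  (* For each permutation s, exactly one u satisfies t = u o s, and by symmetry
     w u = w t; hence the r! summands w t. *)
  transitivity (\sum_u (\sum_(s : 'S_r)
      \prod_p (tnth t p == tnth u (s p))%:R : R) *: w u).
    under eq_bigr do rewrite scaler_suml.
    rewrite exchange_big /=.
    rewrite (eq_bigr (fun=> w t)) ?sumr_const ?card_Sn ?scaler_nat // => s _.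
    rewrite (reindex_inj (h := tuple_perm s^-1%g)); last first.
      move=> u v /(congr1 (tuple_perm s)) uv; apply/eq_from_tnth => i.
      have /= := congr1 (fun z => tnth z i) uv.
      by rewrite !tnth_mktuple permK.
    rewrite (bigD1 t) //= [X in _ + X]big1 ?addr0 => [|u utn].
      rewrite big1 ?scale1r ?symw // => p _.
      by rewrite tnth_mktuple permK eqxx.
    have [p tup] : exists p, tnth t p != tnth u p.
      apply/existsP; rewrite -negb_forall; apply: contraNN utn => /forallP tu.
      by apply/eqP/esym/eq_from_tnth => p; apply/eqP.
    by rewrite (bigD1 p) //= tnth_mktuple permK (negbTE tup) mul0r scale0r.
  rewrite scaler_sumr; apply: eq_bigr => u _.
  rewrite sum_ffunE scaler_sumr.
  rewrite -(ryser_permanent (fun p j => (tnth t p == tnth u j)%:R : R)) scaler_suml.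
  apply: eq_bigr => S _; rewrite !ffunE !scalerA; congr (_ *: _).
  rewrite !mulrA mulfV // mul1r; congr (_ * _); apply: eq_bigr => p _.
  by rewrite mxE.
apply: memv_suml => t _; apply: memv_suml => S _; apply: memvZ.
apply/vspanP/mem_lspan/mem_lspan.
by exists (w t) => //; exists (tpow r (e S t)) => //; apply/mem_lspan; exists (e S t).
Qed.

(** * Curl-free tensors have rank one *)

Definition subst_tuple (n r : nat) (t : r.-tuple 'I_n) (p : 'I_r) (i : 'I_n) :
  r.-tuple 'I_n := [tuple if q == p then i else tnth t q | q < r].

(** The kernel of the symbol at xi of the curl. The index is replaced in
    every position p, and not only in the first, so that [curl_free_rank_one] can
    change all r indices one after the other. *)
Definition curl_free (K : fieldType) (X : lmodType K) (n r : nat)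
    (xi : 'rV[K]_n) (w : tens n r X) : Prop :=
  forall (p : 'I_r) (i : 'I_n) t,
    xi 0 i *: w t - xi 0 (tnth t p) *: w (subst_tuple t p i) = 0.

Lemma curl_free_tprod (K : fieldType) (X : lmodType K) (n r : nat)
    (xi : 'rV[K]_n) (v : X) : curl_free xi (tprod v (tpow r xi)).
Proof.
move=> p i t; apply/eqP; rewrite subr_eq0; apply/eqP.
rewrite !ffunE !scalerA; congr (_ *: _).
rewrite (bigD1 p) //= [in RHS](bigD1 p) //= tnth_mktuple eqxx mulrCA.
by congr (_ * (_ * _)); apply: eq_bigr => q /negbTE qp; rewrite tnth_mktuple qp.
Qed.

(** With xi_i nonzero, r uses of the curl condition give
    xi_i^r w_t = (xi_(t_1) ... xi_(t_r)) w_(i ... i), so v is the entry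
    w_(i ... i) divided by xi_i^r. *)
Lemma curl_free_rank_one (K : fieldType) (X : lmodType K) (n r : nat)
    (xi : 'rV[K]_n) (w : tens n r X) :
  xi != 0 -> curl_free xi w -> exists v, w = tprod v (tpow r xi).
Proof.
move=> /rV0Pn[i xi0] wcf.
pose head m (t : r.-tuple 'I_n) : r.-tuple 'I_n :=
  [tuple if (q < m)%N then i else tnth t q | q < r].
(* Trade the entries of the index t for the fixed index i, one at a time. *)
have wE t m : (m <= r)%N ->
    xi 0 i ^+ m *: w t
    = (\prod_(q < r | (q < m)%N) xi 0 (tnth t q)) *: w (head m t).
  elim: m => [_|m IHm mr].
    rewrite expr0 big_pred0 //; congr (_ *: w _).
    by apply/eq_from_tnth => q; rewrite tnth_mktuple.
  rewrite exprS -scalerA IHm 1?ltnW // scalerA mulrC -scalerA.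
  have /eqP := wcf (Ordinal mr) i (head m t).
  rewrite subr_eq0 => /eqP->; rewrite tnth_mktuple /= ltnn scalerA.
  congr (_ *: w _).
    rewrite [in RHS](bigD1 (Ordinal mr)) //= mulrC; congr (_ * _).
    by apply: eq_bigl => q; rewrite -val_eqE /= ltnS ltn_neqAle andbC.
  apply/eq_from_tnth => q; rewrite !tnth_mktuple -val_eqE /= ltnS [in RHS]leq_eqVlt.
  by case: eqP.
exists ((xi 0 i ^+ r)^-1 *: w [tuple i | q < r]).
apply/ffunP => t; rewrite !ffunE.
apply: (@scalerI _ _ (xi 0 i ^+ r)); first by rewrite expf_neq0.
rewrite wE // !scalerA mulrAC mulfV ?expf_neq0 // mul1r.
congr (_ *: w _); first by apply: eq_bigl => q; rewrite ltn_ord.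
by apply/eq_from_tnth => q; rewrite !tnth_mktuple ltn_ord.
Qed.

(** The tensor product with a line consists of pure tensors. *)
Lemma tens_of_tpow (K : fieldType) (X : lmodType K) (n r : nat)
    (N : set X) (xi : 'rV[K]_n) :
  N 0 -> (forall c u v, N u -> N v -> N (c *: u + v)) ->
  tens_of N (lspan [set tpow r xi]) = [set tprod v (tpow r xi) | v in N].
Proof.
move=> N0 NZD.
have NZ c u : N u -> N (c *: u) by move=> Nu; rewrite -[_ *: _]addr0; exact: NZD.
have Nsum m (x : 'I_m -> X) : (forall i, N (x i)) -> N (\sum_(i < m) x i).
  move=> Nx; apply: (big_ind N) => // u v Nu Nv.
  by rewrite -[u]scale1r; exact: NZD.
apply/seteqP; split=> w.
  move=> [m [c [s [sS ->]]]].
  have /choice[v vP] i : exists v, N v /\ s i = tprod v (tpow r xi).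
    (* A multiple of xi^(x)r is absorbed in the first factor. *)
    have [u Nu [_ [l [d [T [TS ->]]]] <-]] := sS i.
    exists ((\sum_j d j) *: u); split; first exact: NZ.
    apply/ffunP => t; rewrite !ffunE sum_ffunE !scalerA mulr_sumr.
    congr (_ *: _); apply: eq_bigr => j _.
    by rewrite !ffunE TS ffunE mulrC.
  exists (\sum_i c i *: v i).
    by apply: Nsum => i; apply: NZ; case: (vP i).
  apply/ffunP => t; rewrite ffunE sum_ffunE scaler_sumr.
  by apply: eq_bigr => i _; rewrite !ffunE (vP i).2 !ffunE !scalerA mulrC.
move=> [v Nv <-]; apply/mem_lspan; exists v => //.
by exists (tpow r xi) => //; exact/mem_lspan.
Qed.

Lemma symbol_linear (K : fieldType) (X Y : lmodType K) (n k : nat)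
    (A : mindex n k -> X -> Y) (xi : 'rV[K]_n) :
  (forall a, linear (A a)) -> linear (symbol A xi).
Proof.
move=> linA c u v; rewrite /symbol scaler_sumr -big_split /=.
by apply: eq_bigr => a _; rewrite linA scalerDr !scalerA mulrC.
Qed.

(** Kernel stability over an arbitrary field. U stands for V (x) E_r or its
    complexification, arr for its embedding in the space of all arrays, and P and
    the curl for the two components of the symbol S of B at xi. *)
Lemma curl_kernel (K : fieldType) (U X Y Z : lmodType K) (n k r : nat)
    (A : mindex n k -> X -> Y) (xi : 'rV[K]_n)
    (arr : U -> tens n r X) (S : U -> Z) (P : tens n r X -> Y) :
  (forall a, linear (A a)) -> xi != 0 ->
  (forall v, exists w, arr w = tprod v (tpow r xi)) ->
  (forall v, P (tprod v (tpow r xi)) = symbol A xi v) ->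
  (forall w, S w = 0 <-> P (arr w) = 0 /\ curl_free xi (arr w)) ->
  [set arr w | w in kerset S]
  = tens_of (kerset (symbol A xi)) (lspan [set tpow r xi]).
Proof.
move=> linA xi0 arr_onto PE SE.
have linS := symbol_linear xi linA.
rewrite tens_of_tpow; first last.
- by move=> c u v Nu Nv; rewrite /kerset /= linS Nu Nv scaler0 addr0.
- have := linS (-1) 0 0; rewrite scaler0 add0r scaleN1r addNr.
  by [].
apply/seteqP; split=> [_ [w /SE[Pw wcf] <-]|_ [v Av <-]].
  have [v wv] := curl_free_rank_one xi0 wcf.
  by exists v; rewrite ?wv // /kerset /= -PE -wv.
have [w wv] := arr_onto v; exists w => //.
by apply/SE; rewrite wv PE; split=> //; exact: curl_free_tprod.
Qed.

(** * Partial derivatives commute *)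

Lemma is_derive_line (R : realType) (X : normedModType R) (f : X -> R)
    (x v : X) (s : R) :
  derivable f (x + s *: v) v ->
  is_derive s 1 (fun s => f (x + s *: v)) ('D_v f (x + s *: v)).
Proof.
have quotE : (fun d : R => d^-1 *: (((fun s => f (x + s *: v)) \o shift s) (d *: 1)
                 - f (x + s *: v)))
    = (fun d => d^-1 *: ((f \o shift (x + s *: v)) (d *: v) - f (x + s *: v))).
  apply/funext => d /=; congr (_ *: (f _ - _)).
  by rewrite [d *: 1]mulr1 scalerDl addrCA.
by move=> dfv; split; rewrite /derivable /derive quotE.
Qed.

Lemma second_difference (R : realType) (X : normedModType R) (f : X -> R)
    (x v w : X) (h : R) :
  0 < h -> (forall y, derivable f y v) -> (forall y, derivable ('D_v f) y w) ->
  exists s t, [/\ 0 < s < h, 0 < t < h &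
    f (x + h *: v + h *: w) - f (x + h *: v) - f (x + h *: w) + f x
    = 'D_w ('D_v f) (x + s *: v + t *: w) * h * h].
Proof.
move=> h0 dv dvw.
have mvt (g dg : R -> R) : (forall s : R, is_derive s (1 : R) g (dg s)) ->
    exists2 s, 0 < s < h & g h - g 0 = dg s * h.
  move=> gdg; have [|s] := @MVT R g dg 0 h h0 (fun s _ => gdg s).
    apply: derivable_within_continuous => s _.
    by have [] := gdg s.
  by rewrite in_itv /= subr0 => sh ->; exists s.
(* Mean value theorem in the direction v, then in the direction w. *)
pose g s := f (x + h *: w + s *: v) - f (x + s *: v).
have [s sh gE] : exists2 s, 0 < s < h & g h - g 0 =
    ('D_v f (x + h *: w + s *: v) - 'D_v f (x + s *: v)) * h.
  by apply: mvt => s; apply: is_deriveB; exact: is_derive_line.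
have [t th tE] := mvt _ _ (fun t => is_derive_line (dvw (x + s *: v + t *: w))).
exists s, t; split=> //.
rewrite -tE scale0r addr0 (addrAC x (s *: v)) -gE /g scale0r !addr0.
by rewrite (addrAC x (h *: w)) opprB [RHS]addrA [RHS]addrAC.
Qed.

(** Schwarz's theorem. By [second_difference], the two mixed derivatives take a
    common value at points arbitrarily close to x, since the second difference is
    symmetric in v and w; continuity then forces them to agree at x. *)
Lemma derive_comm (R : realType) (X : normedModType R) (f : X -> R) (x v w : X) :
  (forall y, derivable f y v) -> (forall y, derivable f y w) ->
  (forall y, derivable ('D_v f) y w) -> (forall y, derivable ('D_w f) y v) ->
  {for x, continuous ('D_w ('D_v f))} -> {for x, continuous ('D_v ('D_w f))} ->
  'D_w ('D_v f) x = 'D_v ('D_w f) x.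
Proof.
(* Two points of the balls of radius |a - b| / 2 about a and b cannot agree. *)
have halves (a b p q : R) : `|a - p| < `|a - b| / 2 ->
    `|b - q| < `|a - b| / 2 -> p = q -> false.
  move=> ap bq pq; move: bq; rewrite distrC -pq => bp.
  have := ltrD ap bp; rewrite -splitr => /(le_lt_trans (ler_normD _ _)).
  by rewrite addrA subrK ltxx.
move=> dv dw dvw dwv cvw cwv; apply/eqP; rewrite -subr_eq0 -normr_eq0.
apply: contraT => dist_neq0.
set a := 'D_w ('D_v f) x in cvw dist_neq0 *.
set b := 'D_v ('D_w f) x in cwv dist_neq0 *.
have e0 : 0 < `|a - b| / 2 by rewrite divr_gt0 // lt_def dist_neq0 normr_ge0.
have /cvgrPdist_lt /(_ _ e0) near_a := cvw.
have /cvgrPdist_lt /(_ _ e0) near_b := cwv.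
have /nbhs_ballP[d /= d0 dP] := @filterI _ _ (nbhs_filter x) _ _ near_a near_b.
(* Small enough that x + s v + t w stays in the d-ball for s, t in ]0, h[. *)
pose h := d / (`|v| + `|w| + 1).
have den0 : 0 < `|v| + `|w| + 1 by rewrite ltr_wpDl // addr_ge0.
have h0 : 0 < h by rewrite divr_gt0.
have in_ball s t : 0 < s < h -> 0 < t < h -> ball x d (x + s *: v + t *: w).
  move=> /andP[s0 sh] /andP[t0 th]; rewrite -ball_normE /=.
  rewrite -addrA opprD addrA subrr sub0r normrN.
  rewrite (le_lt_trans (ler_normD _ _)) // !normrZ !gtr0_norm //.
  rewrite (@le_lt_trans _ _ (h * (`|v| + `|w|))) //.
    by rewrite mulrDr lerD // ler_wpM2r // ltW.
  by rewrite /h mulrAC ltr_pdivrMr // ltr_pM2l // ltrDl.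
have [s [t [sh th E]]] := second_difference x h0 dv dvw.
have [s' [t' [sh' th' E']]] := second_difference x h0 dw dwv.
have [Ha _] := dP _ (in_ball _ _ sh th).
have := dP _ (in_ball _ _ th' sh'); rewrite addrAC => -[_ Hb].
have eqD : 'D_w ('D_v f) (x + s *: v + t *: w)
    = 'D_v ('D_w f) (x + s' *: w + t' *: v).
  apply: (mulIf (lt0r_neq0 h0)); apply: (mulIf (lt0r_neq0 h0)).
  apply: etrans (esym E) _; apply: etrans E'.
  by rewrite (addrAC x (h *: w)); congr (_ + _); exact: addrAC.
exact: (@halves a b _ _ Ha Hb eqD).
Qed.

Lemma derivable_fin_sum (R : realType) (X : normedModType R) (I : finType)
    (h : I -> X -> R) (x v : X) :
  (forall i, derivable (h i) x v) -> derivable (fun y => \sum_i h i y) x v.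
Proof.
move=> dh; have -> : (fun y => \sum_i h i y) = \sum_i h i.
  by apply/funext => y; rewrite fct_sumE.
apply: (big_ind (fun g : X -> R => derivable g x v)).
- exact: derivable_cst.
- by move=> g1 g2 dg1 dg2; exact: derivableD.
- by move=> i _; exact: dh.
Qed.

Lemma eq_pd (R : realType) (V : vectType R) (n : nat) (i j : 'I_n)
    (u w : 'rV[R]_n -> V) (x : 'rV[R]_n) :
  (forall b, 'D_(delta_mx 0 i) (vcoord u b) x = 'D_(delta_mx 0 j) (vcoord w b) x) ->
  pd i u x = pd j w x.
Proof. by move=> E; rewrite /pd; apply: eq_bigr => b _; rewrite E. Qed.

Lemma vcoord_pd (R : realType) (V : vectType R) (n : nat) (i : 'I_n)
    (u : 'rV[R]_n -> V) b : vcoord (pd i u) b = 'D_(delta_mx 0 i) (vcoord u b).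
Proof.
by apply/funext => x; rewrite /vcoord /pd coord_sum_free ?(basis_free (vbasisP _)).
Qed.

Lemma pd_lfun (R : realType) (V X : vectType R) (n : nat) (i : 'I_n)
    (f : 'Hom(V, X)) (u : 'rV[R]_n -> V) (x : 'rV[R]_n) :
  (forall b, derivable (vcoord u b) x (delta_mx 0 i)) ->
  (forall c, derivable (vcoord (f \o u) c) x (delta_mx 0 i)) /\
  pd i (f \o u) x = f (pd i u x).
Proof.
move=> du.
have fuE c : vcoord (f \o u) c
    = \sum_(b < \dim {:V}) (coord (vbasis {:X}) c (f (vbasis {:V})`_b) \*: vcoord u b).
  apply/funext => y; rewrite fct_sumE /vcoord /=.
  rewrite {1}(coord_vbasis (memvf (u y))) !linear_sum /=.
  by apply: eq_bigr => b _; rewrite !linearZ /= mulrC.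
have dfu c (b : 'I_(\dim {:V})) : derivable (coord (vbasis {:X}) c (f (vbasis {:V})`_b)
    \*: vcoord u b) x (delta_mx 0 i) by exact: derivableZ.
split=> [c|]; first by rewrite fuE; apply: derivable_sum => b; exact: dfu.
have -> : f (pd i u x) = \sum_(b < \dim {:V})
    'D_(delta_mx 0 i) (vcoord u b) x *: f (vbasis {:V})`_b.
  by rewrite /pd linear_sum; apply: eq_bigr => b _; exact: linearZ.
rewrite [RHS](coord_vbasis (memvf _)) /pd; apply: eq_bigr => c _.
congr (_ *: _); rewrite fuE linear_sum.
rewrite (derive_sum (dfu c)); apply: eq_bigr => b _.
by rewrite [RHS]linearZ /=; apply: etrans (deriveZ _ (du b)) (mulrC _ _).
Qed.

Lemma Ck_foldr (R : realType) (V : vectType R) (n m : nat) (s : seq 'I_n)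
    (u : 'rV[R]_n -> V) :
  Ck (m + size s) u -> Ck m (foldr (@pd R V n) u s).
Proof.
elim: s m => [|i s IHs] m /=; first by rewrite addn0.
by rewrite addnS -addSn => /IHs[_ /(_ i)[]].
Qed.

Lemma pd_comm (R : realType) (V : vectType R) (n m : nat) (i j : 'I_n)
    (u : 'rV[R]_n -> V) :
  Ck m.+2 u -> pd i (pd j u) = pd j (pd i u).
Proof.
move=> [_ Cu]; apply/funext => x.
have [di [_ Cdi]] := Cu i; have [dj [_ Cdj]] := Cu j.
have [dij Cij] := Cdi j; have [dji Cji] := Cdj i.
have Ccont (g : 'rV[R]_n -> V) : Ck m g -> forall b, continuous (vcoord g b).
  by case: (m) => [|m'] [].
apply: eq_pd => b.
have := Ccont _ Cji b x; rewrite (vcoord_pd i (pd j u)) (vcoord_pd j u) => cji.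
have := Ccont _ Cij b x; rewrite (vcoord_pd j (pd i u)) (vcoord_pd i u) => cij.
have dij' y := dij b y; rewrite (vcoord_pd i u) in dij'.
have dji' y := dji b y; rewrite (vcoord_pd j u) in dji'.
exact: (derive_comm (dj b) (di b) dji' dij' cji cij).
Qed.

Lemma foldr_pd_perm (R : realType) (V : vectType R) (n m : nat)
    (s1 s2 : seq 'I_n) (u : 'rV[R]_n -> V) :
  Ck (m + size s1) u -> perm_eq s1 s2 ->
  foldr (@pd R V n) u s1 = foldr (@pd R V n) u s2.
Proof.
(* A derivative in the middle of the word can be moved to its front. *)
have move_front i (p q : seq 'I_n) m' : Ck (m' + (size (p ++ q)).+1) u ->
    foldr (@pd R V n) u (p ++ i :: q) = pd i (foldr (@pd R V n) u (p ++ q)).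
  elim: p m' => [|j p IHp] m' //= Cu.
  rewrite (IHp m'.+1); last by rewrite addSn -addnS.
  by apply: (@pd_comm _ _ _ m'); apply: Ck_foldr; rewrite !addSn -!addnS.
elim: s1 m s2 => [|i s1 IHs] m s2 Cu s12.
  by move: s12; rewrite perm_sym => /perm_nilP->.
have /path.splitPr is2 : i \in s2 by rewrite -(perm_mem s12) mem_head.
case: is2 s12 => p q; rewrite -[p ++ _ :: _]cat_rcons.
rewrite perm_sym cat_rcons -cat1s perm_catCA /= perm_cons perm_sym => s12.
rewrite (move_front i p q m); last by rewrite -(perm_size s12).
by rewrite (IHs m.+1 _ _ s12) //; rewrite addSn -addnS.
Qed.

Lemma symmetric_derivatives (R : realType) (V : vectType R) (n m r : nat)
    (u : 'rV[R]_n -> V) (x : 'rV[R]_n) :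
  Ck (m + r) u ->
  symmetric_tens [ffun t : r.-tuple 'I_n => foldr (@pd R V n) u t x].
Proof.
move=> Cu s t; rewrite !ffunE.
rewrite (@foldr_pd_perm _ _ _ m _ t) ?size_tuple //.
by apply/tuple_permP; exists s.
Qed.

(** * Multi-indices as words *)

(** The sorted word with val a i occurrences of each i. Its letters are in the
    order in which pdm applies the partial derivatives. *)
Definition mindex_seq (n k : nat) (a : mindex n k) : seq 'I_n :=
  flatten [seq nseq (val a i) i | i <- enum 'I_n].

Lemma size_mindex_seq (n k : nat) (a : mindex n k) :
  size (mindex_seq a) == k.
Proof.
rewrite size_flatten /shape -map_comp sumnE big_map big_enum /=.
by rewrite -[X in _ == X](eqP (valP a)); under eq_bigr do rewrite size_nseq.
Qed.

Definition mindex_tuple (n k : nat) (a : mindex n k) : k.-tuple 'I_n :=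
  Tuple (size_mindex_seq a).

Lemma monomial_mindex_tuple (K : fieldType) (n k : nat) (a : mindex n k)
    (xi : 'rV[K]_n) :
  \prod_i xi 0 i ^+ val a i = \prod_(i <- mindex_tuple a) xi 0 i.
Proof.
rewrite /= /mindex_seq big_flatten big_map big_enum /=; apply: eq_bigr => i _.
by elim: (val a i : nat) => [|m IHm]; rewrite /= ?big_nil // big_cons exprS IHm.
Qed.

Lemma pdmE (R : realType) (V : vectType R) (n k : nat) (a : mindex n k)
    (u : 'rV[R]_n -> V) :
  pdm a u = foldr (@pd R V n) u (mindex_seq a).
Proof.
rewrite /pdm /mindex_seq; elim: (enum 'I_n) => //= i s ->.
by rewrite foldr_cat; elim: (val a i : nat) => //= m ->.
Qed.

(** * The two components of the operator *)

(** The j-th coefficient of A viewed as a first-order operator on D^r u: the first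
    letter j of the word of alpha is the derivative taken, the other r letters
    select the entry of the array. *)
Definition first_order (X : Type) (Y : nmodType) (n r : nat)
    (A : mindex n r.+1 -> X -> Y) (j : 'I_n) (w : tens n r X) : Y :=
  \sum_(a | thead (mindex_tuple a) == j) A a (w (behead_tuple (mindex_tuple a))).

Definition curl (K : fieldType) (X : lmodType K) (n r : nat) (j : 'I_n)
    (w : tens n r X) (q : 'I_r * 'I_n * r.-tuple 'I_n) : X :=
  let: (p, i, t) := q in
  (i == j)%:R *: w t - (tnth t p == j)%:R *: w (subst_tuple t p i).

Lemma sum_delta (K : fieldType) (X : lmodType K) (n : nat) (c : 'I_n -> K)
    (i : 'I_n) (x : X) : \sum_j c j *: ((i == j)%:R *: x) = c i *: x.
Proof.
rewrite (bigD1 i) //= eqxx scale1r big1 ?addr0 // => j.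
by rewrite eq_sym => /negbTE->; rewrite scale0r scaler0.
Qed.

Lemma sum_curl (K : fieldType) (X : lmodType K) (n r : nat) (xi : 'rV[K]_n)
    (w : tens n r X) p i t :
  \sum_j xi 0 j *: curl j w (p, i, t)
  = xi 0 i *: w t - xi 0 (tnth t p) *: w (subst_tuple t p i).
Proof.
under eq_bigr do rewrite /curl scalerBr.
by rewrite sumrB !sum_delta.
Qed.

(** The monomial xi^alpha is the product of xi_j, from the symbol, and the entry
    of xi^(x)r at the tail of the word of alpha. *)
Lemma sum_first_order_tprod (K : fieldType) (X Y : lmodType K) (n r : nat)
    (A : mindex n r.+1 -> X -> Y) (xi : 'rV[K]_n) (v : X) :
  (forall a, linear (A a)) ->
  \sum_j xi 0 j *: first_order A j (tprod v (tpow r xi)) = symbol A xi v.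
Proof.
move=> linA; rewrite /symbol.
rewrite (partition_big (fun a => thead (mindex_tuple a)) predT) //=.
apply: eq_bigr => j _; rewrite scaler_sumr; apply: eq_bigr => a /eqP <-.
rewrite monomial_mindex_tuple.
have linAZ c x : A a (c *: x) = c *: A a x.
  have A0 : A a 0 = 0 by have := linA a (-1) 0 0; rewrite scaler0 add0r scaleN1r addNr.
  by have := linA a c x 0; rewrite A0 !addr0.
rewrite !ffunE linAZ scalerA; congr (_ *: _).
case/tupleP: (mindex_tuple a) => i t.
rewrite theadE big_cons; congr (_ * _).
by rewrite big_tuple; apply: eq_bigr => l _; rewrite !(tnth_nth i).
Qed.

Lemma first_order_linear (K : fieldType) (X Y : lmodType K) (n r : nat)
    (A : mindex n r.+1 -> X -> Y) (j : 'I_n) :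
  (forall a, linear (A a)) -> linear (@first_order X Y n r A j).
Proof.
move=> linA c w1 w2; rewrite /first_order scaler_sumr -big_split /=.
by apply: eq_bigr => a _; rewrite !ffunE linA.
Qed.

Lemma curl_linear (K : fieldType) (X : lmodType K) (n r : nat) (j : 'I_n) q :
  linear (fun w : tens n r X => curl j w q).
Proof.
case: q => -[p i] t c w1 w2; rewrite /curl !ffunE.
rewrite scalerBr !scalerDr !scalerA opprD addrACA.
by rewrite !(mulrC c).
Qed.

(** * Membership in V (x) E_r and complexification *)

Lemma lfun_exists (K : fieldType) (X Y : vectType K) (f : X -> Y) :
  linear f -> exists F : 'Hom(X, Y), F =1 f.
Proof.
move=> linf; pose f_linear := GRing.isLinear.Build K X Y *:%R f linf.
pose f' : {linear X -> Y} := HB.pack f f_linear.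
by exists (linfun f') => x; exact: lfunE.
Qed.

Lemma tpow_symmetric (K : fieldType) (n r : nat) (xi : 'rV[K]_n) :
  symmetric_tens (tpow r xi).
Proof.
move=> s t; rewrite !ffunE [RHS](reindex_perm s).
by apply: eq_bigr => p _; rewrite tnth_mktuple.
Qed.

Lemma tprod_tpow_symmetric (K : fieldType) (X : lmodType K) (n r : nat) (v : X)
    (xi : 'rV[K]_n) : symmetric_tens (tprod v (tpow r xi)).
Proof. by move=> s t; rewrite [LHS]ffunE [RHS]ffunE tpow_symmetric. Qed.

Lemma vsval_tvec (R : realType) (V : vectType R) (n r : nat) (v : V)
    (xi : 'rV[R]_n) : vsval (tvec r v xi) = tprod v (tpow r xi).
Proof.
exact/vsprojK/symmetric_in_symtensv/tprod_tpow_symmetric.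
Qed.

(** The real and imaginary parts of a power of a complex xi are not multiples of
    powers of real vectors, but they are symmetric, hence still in V (x) E_r. *)
Lemma cval_ctvec (R : realType) (V : vectType R) (n r : nat) (v : cplx V)
    (xi : 'rV[R[i]]_n) : cval (ctvec r v xi) = tprod v (tpow r xi).
Proof.
apply/ffunP => t; rewrite ffunE /= !vsprojK.
- by rewrite !ffunE.
- by apply: symmetric_in_symtensv => s u; rewrite ffunE tprod_tpow_symmetric [RHS]ffunE.
- by apply: symmetric_in_symtensv => s u; rewrite ffunE tprod_tpow_symmetric [RHS]ffunE.
Qed.

Lemma cmap_linear (R : realType) (V W : vectType R) (f : 'Hom(V, W)) :
  linear (cmap f).
Proof.
move=> c u v; rewrite /cmap /= /GRing.scale /= /cplx_scale /=.
by congr (_, _); rewrite !linearD ?linearN !linearZ.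
Qed.

Lemma cmap_sum (R : realType) (V W : vectType R) (f : 'Hom(V, W))
    (n : nat) (c : 'I_n -> R[i]) (z : 'I_n -> cplx V) :
  cmap f (\sum_j c j *: z j) = \sum_j c j *: cmap f (z j).
Proof.
have fD : {morph cmap f : x y / x + y} by move=> x y; rewrite -[x]scale1r cmap_linear !scale1r.
have f0 : cmap f 0 = 0 by rewrite /cmap /= !linear0.
rewrite (big_morph _ fD f0); apply: eq_bigr => j _.
by rewrite -[_ *: z j]addr0 cmap_linear f0 addr0.
Qed.

Lemma cplx_sum (R : realType) (V : vectType R) (I : finType) (P : pred I)
    (x y : I -> V) :
  \sum_(a | P a) ((x a, y a) : cplx V) = (\sum_(a | P a) x a, \sum_(a | P a) y a).
Proof.
elim/big_rec3: _ => // a s1 s2 s3 _ ->. by [].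
Qed.

Lemma first_order_cval (R : realType) (V W : vectType R) (n r : nat)
    (A : mindex n r.+1 -> 'Hom(V, W)) (j : 'I_n) (w : cplx (VE V n r)) :
  first_order (fun a => cmap (A a)) j (cval w)
  = (first_order (fun a => A a) j (vsval w.1),
     first_order (fun a => A a) j (vsval w.2)).
Proof.
rewrite /first_order -cplx_sum; apply: eq_bigr => a _.
by rewrite /cmap ffunE.
Qed.

Lemma curl_cval (R : realType) (V : vectType R) (n r : nat) (j : 'I_n)
    (w : cplx (VE V n r)) q :
  curl j (cval w) q = (curl j (vsval w.1) q, curl j (vsval w.2) q).
Proof.
have scale_nat (b : bool) (x y : V) :
    b%:R *: ((x, y) : cplx V) = (b%:R *: x, b%:R *: y).
  by case: b; rewrite ?scale1r ?scale0r.
by case: q => -[p i] t; rewrite /curl !ffunE !scale_nat.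
Qed.

(** * The factorization *)

(** Differentiation of the V (x) E_r-valued map fullD r u is entrywise; the entries
    of fullD r u are the derivatives of u themselves, not a projection of them,
    because the array is symmetric. *)
Lemma pd_fullD (R : realType) (V : vectType R) (n r : nat)
    (u : 'rV[R]_n -> V) (j : 'I_n) (t : r.-tuple 'I_n) (x : 'rV[R]_n) :
  Ck r.+1 u ->
  vsval (pd j (fullD r u) x) t = foldr (@pd R V n) u (j :: t) x.
Proof.
move=> Cu.
have Ct (t' : r.-tuple 'I_n) : Ck 1 (foldr (@pd R V n) u t').
  by apply: Ck_foldr; rewrite size_tuple add1n.
(* The derivative of the array is computed through the evaluation of its t-th
   entry, which needs all coordinates of fullD r u, in a basis of V (x) E_r, to
   be derivable: they are sums over t' of linear images of the entries. *)
have [ev evE] : exists F : 'Hom(VE V n r, V), forall w, F w = vsval w t.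
  by apply: lfun_exists => c w1 w2; rewrite linearP !ffunE.
have /choice[inj injE] (t' : r.-tuple 'I_n) : exists F : 'Hom(V, VE V n r),
    forall v, F v = vsproj (symtensv V n r) [ffun s => if s == t' then v else 0].
  apply: lfun_exists => c v1 v2; rewrite -linearP; congr (vsproj _ _).
  by apply/ffunP => s; rewrite !ffunE; case: ifP => // _; rewrite scaler0 addr0.
have fullDE : fullD r u = fun y => \sum_t' inj t' (foldr (@pd R V n) u t' y).
  apply/funext => y; under eq_bigr do rewrite injE.
  rewrite -linear_sum; congr (vsproj _ _); apply/ffunP => s.
  rewrite sum_ffunE ffunE (bigD1 s) //= ffunE eqxx big1 ?addr0 // => s'.
  by rewrite ffunE eq_sym => /negbTE->.
have dfullD b : derivable (vcoord (fullD r u) b) x (delta_mx 0 j).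
  have -> : vcoord (fullD r u) b = fun y =>
      \sum_t' vcoord (inj t' \o foldr (@pd R V n) u t') b y.
    by apply/funext => y; rewrite fullDE /vcoord linear_sum.
  apply: derivable_fin_sum => t'; apply: (pd_lfun _ _).1 => c.
  by have [_ /(_ j)[]] := Ct t'.
have [_] := pd_lfun ev dfullD.
rewrite evE => <- /=; congr (pd j _ x); apply/funext => y /=.
rewrite evE /fullD vsprojK ?ffunE //.
by apply: symmetric_in_symtensv; apply: (@symmetric_derivatives _ _ _ 1).
Qed.

Theorem theorem20 (R : realType) (V W : vectType R)
    (dotV : {dot V for idfun}) (dotW : {dot W for idfun})
    (n k : nat) (hk : (2 <= k)%N) (A : mindex n k -> 'Hom(V, W)) :
  exists (Z : vectType R) (iotaW : 'Hom(W, Z)) (PW : 'Hom(Z, W))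
         (B : 'I_n -> 'Hom(VE V n k.-1, Z)),
    [/\ (PW \o iotaW)%VF = \1%VF,
        (* (i) *)
        forall u : 'rV[R]_n -> V, Ck k u ->
          diffop A u = PW \o diffop1 B (fullD k.-1 u),
        (* (ii) *)
        (forall (xi : 'rV[R]_n) (v : V),
          symbol (fun a => A a) xi v
          = PW (symbol1 (fun j => B j) xi (tvec k.-1 v xi))) /\
        (forall (xi : 'rV[R[i]]_n) (v : cplx V),
          symbol (fun a => cmap (A a)) xi v
          = cmap PW (symbol1 (fun j => cmap (B j)) xi (ctvec k.-1 v xi)))
      & (* (iii) *)
        (forall xi : 'rV[R]_n, xi != 0 ->
          [set vsval w | w in kerset (symbol1 (fun j => B j) xi)]
          = tens_of (kerset (symbol (fun a => A a) xi))
                    (lspan [set tpow k.-1 xi])) /\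
        (forall xi : 'rV[R[i]]_n, xi != 0 ->
          [set cval w | w in kerset (symbol1 (fun j => cmap (B j)) xi)]
          = tens_of (kerset (symbol (fun a => cmap (A a)) xi))
                    (lspan [set tpow k.-1 xi]))].
Proof.
case: k hk A => [//|r] _ A.
(* Z is the sum of W and the target of the curl. *)
pose Q : finType := ('I_r * 'I_n * r.-tuple 'I_n)%type.
pose Z : vectType R := (W * {ffun Q -> V})%type.
have linA a : linear (A a) by move=> c x y; exact: linearP.
have linAC a : linear (cmap (A a)) by exact: cmap_linear.
have [iotaW iotaWE] : exists F : 'Hom(W, Z), forall y, F y = (y, 0).
  by apply: lfun_exists => c y1 y2; congr (_, _); rewrite /= scaler0 addr0.
have [PW PWE] : exists F : 'Hom(Z, W), forall z, F z = z.1.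
  by apply: lfun_exists.
have /choice[ev evE] (q : Q) : exists F : 'Hom(Z, V), forall z, F z = z.2 q.
  by apply: lfun_exists => c z1 z2 /=; rewrite !ffunE.
have /choice[B BE] (j : 'I_n) : exists F : 'Hom(VE V n r, Z), forall w,
    F w = (first_order (fun a => A a) j (vsval w), [ffun q => curl j (vsval w) q]).
  apply: lfun_exists => c w1 w2; congr (_, _).
    by rewrite -first_order_linear // linearP.
  by apply/ffunP => q; rewrite !ffunE -curl_linear linearP.
have PWB j w : PW (B j w) = first_order (fun a => A a) j (vsval w).
  by rewrite PWE BE.
have evB q j w : ev q (B j w) = curl j (vsval w) q.
  by rewrite evE BE ffunE.
(* An element of Z vanishes iff its projections by PW and all ev q do, and
   these commute with the symbol of B. *)
have Z_eq0 (z : Z) : z = 0 <-> PW z = 0 /\ forall q, ev q z = 0.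
  split=> [->|]; first by split=> [|q]; rewrite linear0.
  case: z => y g [] /=; rewrite PWE /= => -> evg; congr (_, _).
  by apply/ffunP => q; have := evg q; rewrite evE /= => ->; rewrite ffunE.
have PWS xi w : PW (symbol1 (fun j => B j) xi w)
    = \sum_j xi 0 j *: first_order (fun a => A a) j (vsval w).
  by rewrite linear_sum; apply: eq_bigr => j _; rewrite linearZ /= PWB.
have evS q xi w : ev q (symbol1 (fun j => B j) xi w)
    = \sum_j xi 0 j *: curl j (vsval w) q.
  by rewrite linear_sum; apply: eq_bigr => j _; rewrite linearZ /= evB.
have PWSC xi w : cmap PW (symbol1 (fun j => cmap (B j)) xi w)
    = \sum_j xi 0 j *: first_order (fun a => cmap (A a)) j (cval w).
  rewrite cmap_sum; apply: eq_bigr => j _.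
  by rewrite first_order_cval /cmap /= !PWB.
have evSC q xi w : cmap (ev q) (symbol1 (fun j => cmap (B j)) xi w)
    = \sum_j xi 0 j *: curl j (cval w) q.
  rewrite cmap_sum; apply: eq_bigr => j _.
  by rewrite curl_cval /cmap /= !evB.
exists Z, iotaW, PW, B; split.
- by apply/lfunP => y; rewrite comp_lfunE iotaWE PWE id_lfunE.
- move=> u Cu; apply/funext => x /=; rewrite /diffop /diffop1 linear_sum.
  rewrite (partition_big (fun a => thead (mindex_tuple a)) predT) //=.
  apply: eq_bigr => j _; rewrite PWB; apply: eq_bigr => a /eqP aj.
  rewrite pd_fullD // pdmE -aj.
  congr (A a (foldr _ _ _ x)).
  by rewrite -[LHS]/(val (mindex_tuple a)) {1}(tuple_eta (mindex_tuple a)).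
- split=> xi v.
    by rewrite PWS vsval_tvec sum_first_order_tprod.
  by rewrite PWSC cval_ctvec sum_first_order_tprod.
- split=> xi xi0.
    pose P (w : tens n r V) := \sum_j xi 0 j *: first_order (fun a => A a) j w.
    apply: (@curl_kernel _ _ _ _ _ _ _ _ _ _ _ _ P) => // [v|v|w].
    + by exists (tvec r v xi); exact: vsval_tvec.
    + exact: sum_first_order_tprod.
    + rewrite Z_eq0 PWS; split=> -[Pw cw]; split=> //.
        by move=> p i t; have := cw (p, i, t); rewrite evS sum_curl.
      by move=> [[p i] t]; rewrite evS sum_curl.
  pose P (w : tens n r (cplx V)) :=
    \sum_j xi 0 j *: first_order (fun a => cmap (A a)) j w.
  apply: (@curl_kernel _ _ _ _ _ _ _ _ _ _ _ _ P) => // [v|v|w].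
  + by exists (ctvec r v xi); exact: cval_ctvec.
  + exact: sum_first_order_tprod.
  + have cplx_Z_eq0 (z : cplx Z) :
        z = 0 <-> cmap PW z = 0 /\ forall q, cmap (ev q) z = 0.
      case: z => z1 z2; split=> [[-> ->]|[[P1 P2] evz]].
        by split=> [|q]; rewrite /cmap /= !linear0.
      have -> : z1 = 0 by apply/Z_eq0; split=> // q; case: (evz q).
      by have -> : z2 = 0 by apply/Z_eq0; split=> // q; case: (evz q).
    rewrite cplx_Z_eq0 PWSC; split=> -[Pw cw]; split=> //.
      by move=> p i t; have := cw (p, i, t); rewrite evSC sum_curl.
    by move=> [[p i] t]; rewrite evSC sum_curl.
Qed.
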